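(* Let $H,K$ be Hilbert spaces and let $T$ be a densely defined closable operator from $D(T)\subset H$ into $K$ which has decomposable domain, $D(T)=N(T)\oplus^{\perp}C(T)$, and satisfies $N(\overline{T})=\overline{N(T)}$. Then $(T^{\dagger})^{*}=(T^{*})^{\dagger}$.
   Context: Operators are linear and defined on a linear subspace $D(T)$ (the domain) of a Hilbert space; $N(T)$ and $R(T)$ are the null space and range. The carrier of $T$ is $C(T)=D(T)\cap N(T)^{\perp}$. $\oplus^{\perp}$ denotes orthogonal direct sum of subspaces. $T$ has decomposable domain if $D(T)=N(T)\oplus^{\perp}C(T)$; every closed operator has decomposable domain, since its null space is closed. For $T$ with decomposable domain, the Moore-Penrose (generalized) inverse is the linear operator $T^{\dagger}:D(T^{\dagger})=R(T)\oplus^{\perp}R(T)^{\perp}\subset K\to H$ determined by $T^{\dagger}y=(T|_{C(T)})^{-1}y$ for $y\in R(T)$ and $T^{\dagger}y=0$ for $y\in R(T)^{\perp}$. $T$ is closable if it has a closed extension; $\overline{T}$ is its minimal closed extension. $T^{*}$ is the adjoint of a densely defined operator. Equality of operators includes equality of domains. *)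

(* Defs.v *)
From HB Require Import structures.
From mathcomp Require Import all_boot all_order all_algebra.
From mathcomp Require Import sesquilinear complex.
From mathcomp Require Import all_classical all_reals all_analysis.
Import Order.TTheory GRing.Theory Num.Theory.
Import numFieldNormedType.Exports.

Set Implicit Arguments.
Unset Strict Implicit.
Unset Printing Implicit Defensive.

Local Open Scope classical_set_scope.
Local Open Scope ring_scope.
Local Open Scope complex_scope.

(* Hilbert spaces may be real or complex: the scalars are either R with the
   trivial conjugation, or R[i] with complex conjugation. *)
Inductive real_or_complex (R : realType) :
    forall F : numFieldType, (F -> F) -> Prop :=
| real_scalars : @real_or_complex R R idfun
| complex_scalars : @real_or_complex R R[i] conjc.

(* A Hilbert space is a complete normed module whose norm is induced by an
   inner product; the inner product is linear in its first argument and
   conjugate-linear in its second argument. *)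
HB.mixin Record CompleteNormedModule_isHilbert (F : numFieldType)
    (theta : F -> F) H of CompleteNormedModule F H := {
  inner : {dot H for theta} ;
  inner_norm : forall x : H, inner x x = `|x| ^+ 2
}.

#[short(type="hilbertType")]
HB.structure Definition Hilbert (F : numFieldType) (theta : F -> F) :=
  {H of CompleteNormedModule F H & CompleteNormedModule_isHilbert F theta H}.

Notation "''[' x , y ]" := (inner x y) : ring_scope.

Section OrthogonalSum.
Context {F : numFieldType} {theta : F -> F} {H : hilbertType theta}.
Implicit Types A B D : set H.

Definition orth A : set H := [set x | forall a, A a -> '[x, a] = 0].

Definition set_sum A B : set H := [set a + b | a in A & b in B].

Definition is_orth_sum D A B : Prop :=
  (forall a b, A a -> B b -> '[a, b] = 0) /\ D = set_sum A B.

End OrthogonalSum.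

(* The values of an operator outside of its domain are irrelevant. *)
Record operator (F : numFieldType) (U V : lmodType F) := Operator {
  dom : set U ;
  op_fun :> U -> V ;
  dom0 : dom 0 ;
  dom_lin : forall a x y, dom x -> dom y -> dom (a *: x + y) ;
  op_lin : forall a x y, dom x -> dom y ->
    op_fun (a *: x + y) = a *: op_fun x + op_fun y
}.

Section OperatorBasics.
Context {F : numFieldType} {U V : lmodType F}.
Implicit Types T S : operator U V.

Definition op_eq T S : Prop :=
  dom T = dom S /\ forall x, dom T x -> T x = S x.

Definition graph T : set (U * V) := [set p | dom T p.1 /\ T p.1 = p.2].

Definition extends T S : Prop := graph T `<=` graph S.

Definition null T : set U := [set x | dom T x /\ T x = 0].

Definition ran T : set V := T @` dom T.

Lemma op0 T : T 0 = 0.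
Proof.
have := op_lin 1 (dom0 T) (dom0 T).
by rewrite !scale1r addr0 => /(congr1 (+%R^~ (- T 0))); rewrite addrK subrr.
Qed.

Definition zero_op : operator U V.
Proof.
by apply: (@Operator F U V setT (fun=> 0)) => // *; rewrite scaler0 addr0.
Defined.

End OperatorBasics.

Section Closure.
Context {F : numFieldType} {theta : F -> F} {H K : hilbertType theta}.
Implicit Types T S : operator H K.

Definition densely_defined T : Prop := dense (dom T).

Definition closed_op T : Prop := closed (graph T).

Definition closable T : Prop := exists2 S, closed_op S & extends T S.

Definition minimal_closed_extension T S : Prop :=
  [/\ closed_op S, extends T S &
      forall S', closed_op S' -> extends T S' -> extends S S'].

Lemma closable_minimal T : closable T ->
  exists S, minimal_closed_extension T S.
Proof.
move=> [S0 cS0 TS0].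
pose G := \bigcap_(S in [set S | closed_op S /\ extends T S]) graph S.
have GS0 x : G (x, S0 x) -> dom S0 x by move=> /(_ S0 (conj cS0 TS0))[].
have G0 : G (0, S0 0) by move=> S _; split=> /=; [exact: dom0|rewrite !op0].
have GL a x y : G (x, S0 x) -> G (y, S0 y) ->
    G (a *: x + y, S0 (a *: x + y)).
  move=> Gx Gy S /[dup] h /[dup] /Gx[/= Sx Sxe] /Gy[/= Sy Sye]; split=> /=.
    exact: dom_lin.
  by rewrite !op_lin ?Sxe ?Sye//; apply: GS0.
pose S := @Operator F H K [set x | G (x, S0 x)] S0 G0 GL
  (fun a x y Gx Gy => op_lin a (GS0 x Gx) (GS0 y Gy)).
have SE : graph S = G.
  apply/seteqP; split=> -[x y]; first by move=> [/= Gx <-].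
  move=> Gxy.
  have /= [_ e] := Gxy S0 (conj cS0 TS0).
  by split=> /=; rewrite e.
exists S; split.
- by rewrite /closed_op SE; apply: closed_bigI => S' [].
- by rewrite /extends SE => p Tp S' [_]; exact.
- by move=> S' cS' TS' p; rewrite SE; apply.
Qed.

(* The minimal closed extension of T if T is closable, and T itself if not. *)
Definition op_closure T : operator H K :=
  if pselect (exists S, minimal_closed_extension T S) is left h
  then sval (cid h) else T.

Lemma op_closureP T : closable T -> minimal_closed_extension T (op_closure T).
Proof.
move=> /closable_minimal h; rewrite /op_closure.
by case: pselect => // h'; case: cid.
Qed.

End Closure.

Section InnerFacts.
Context {F : numFieldType} {theta : F -> F} {H : hilbertType theta}.

Lemma innerDr (x y z : H) : '[x, y + z] = '[x, y] + '[x, z].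
Proof. exact: linearDr. Qed.

Lemma innerDl (x y z : H) : '[x + y, z] = '[x, z] + '[y, z].
Proof. exact: linearDl. Qed.

Lemma innerZl a (x y : H) : '[a *: x, y] = a * '[x, y].
Proof. exact: linearZl_LR. Qed.

Lemma innerZr a (x y : H) : '[x, a *: y] = theta a * '[x, y].
Proof. exact: linearZr_LR. Qed.

Lemma inner0l (y : H) : '[0, y] = 0.
Proof. by rewrite -(scale0r 0) innerZl mul0r. Qed.

Lemma innerBl (x y z : H) : '[x - y, z] = '[x, z] - '[y, z].
Proof. by rewrite -scaleN1r innerDl innerZl mulN1r. Qed.

Lemma inner0r (x : H) : '[x, 0] = 0.
Proof. by apply: (addIr '[x, 0]); rewrite -innerDr !add0r. Qed.

Lemma innerBr (x y z : H) : '[x, y - z] = '[x, y] - '[x, z].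
Proof. by apply: (addIr '[x, z]); rewrite -innerDr !subrK. Qed.

Lemma inner_eq0 (x : H) : '[x, x] = 0 -> x = 0.
Proof.
by move=> /eqP; rewrite inner_norm expf_eq0 /= normr_eq0 => /eqP.
Qed.

Lemma inner_eq0C (x y : H) : '[x, y] = 0 -> '[y, x] = 0.
Proof.
move=> xy; have [->|x0] := eqVneq x 0; first exact: inner0r.
have xx : '[x, x] != 0 by apply: contra_neq x0; exact: inner_eq0.
have c0 : theta 0 = 0.
  apply/eqP; rewrite -(inj_eq (mulIf xx)) mul0r -innerZr scale0r.
  by rewrite inner0r.
have -> : '[y, x] = (-1) ^+ false * theta '[x, y].
  exact: (@hermitian_subproof _ _ _ _ inner).
by rewrite xy c0 mulr0.
Qed.

Lemma dense_orth (D : set H) (w : H) : dense D ->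
  (forall x, D x -> '[x, w] = 0) -> w = 0.
Proof.
move=> dD Dw; apply/eqP/contraT => w0.
have nw : 0 < `|w| by rewrite normr_gt0.
have [] := dD (ball w `|w|); [by exists w; exact: ballxx|exact: ball_open|].
move=> x [bx /Dw xw]; move: bx; rewrite -ball_normE /= => xwlt.
have : `|w| ^+ 2 <= `|w - x| ^+ 2.
  rewrite -!inner_norm innerBl !innerBr xw (inner_eq0C xw).
  by rewrite subr0 sub0r opprK lerDl inner_norm exprn_ge0.
rewrite ler_pXn2r ?nnegrE // => h.
by have := lt_le_trans xwlt h; rewrite ltxx.
Qed.

Lemma orth_lin (A : set H) a x y : orth A x -> orth A y ->
  orth A (a *: x + y).
Proof.
by move=> Ax Ay z Az; rewrite innerDl innerZl Ax // Ay // mulr0 addr0.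
Qed.

End InnerFacts.

Section Adjoint.
Context {F : numFieldType} {theta : F -> F} {H K : hilbertType theta}.
Implicit Type T : operator H K.

(* By the Riesz theorem, the y for which such a z exists are exactly those for
   which x |-> '[T x, y] is bounded on dom T. *)
Definition adjoint_rel T (y : K) (z : H) : Prop :=
  forall x, dom T x -> '[T x, y] = '[x, z].

Definition adjoint_dom T : set K := [set y | exists z, adjoint_rel T y z].

Definition adjoint_fun T (y : K) : H := get (adjoint_rel T y).

Lemma adjoint_funP T y : adjoint_dom T y -> adjoint_rel T y (adjoint_fun T y).
Proof. by move=> [z yz]; exact: (getI yz). Qed.

Lemma adjoint_rel_lin T a y1 z1 y2 z2 : adjoint_rel T y1 z1 ->
  adjoint_rel T y2 z2 -> adjoint_rel T (a *: y1 + y2) (a *: z1 + z2).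
Proof.
move=> h1 h2 x Tx.
by rewrite !innerDr !innerZr h1 // h2.
Qed.

Lemma adjoint_rel_uniq T y z z' : densely_defined T ->
  adjoint_rel T y z -> adjoint_rel T y z' -> z = z'.
Proof.
move=> dT h h'; apply/eqP; rewrite -subr_eq0; apply/eqP.
by apply: (dense_orth dT) => x Tx; rewrite innerBr -h // -h' // subrr.
Qed.

Lemma adjoint_dom0 T : adjoint_dom T 0.
Proof. by exists 0 => x _; rewrite !inner0r. Qed.

Lemma adjoint_dom_lin T a y1 y2 : adjoint_dom T y1 -> adjoint_dom T y2 ->
  adjoint_dom T (a *: y1 + y2).
Proof.
by move=> [z1 h1] [z2 h2]; exists (a *: z1 + z2); exact: adjoint_rel_lin.
Qed.

Lemma adjoint_lin T (dT : densely_defined T) a y1 y2 :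
  adjoint_dom T y1 -> adjoint_dom T y2 ->
  adjoint_fun T (a *: y1 + y2) = a *: adjoint_fun T y1 + adjoint_fun T y2.
Proof.
move=> h1 h2; apply: (adjoint_rel_uniq dT).
  exact/adjoint_funP/adjoint_dom_lin.
by apply: adjoint_rel_lin; exact: adjoint_funP.
Qed.

Definition adjoint_op T (dT : densely_defined T) : operator K H :=
  Operator (adjoint_dom0 T) (@adjoint_dom_lin T) (adjoint_lin dT).

(* The adjoint is meaningful only for a densely defined operator; zero_op is
   a default value. *)
Definition adjoint T : operator K H :=
  if pselect (densely_defined T) is left dT then adjoint_op dT else zero_op.

Lemma adjointP T y z : densely_defined T ->
  graph (adjoint T) (y, z) <-> adjoint_rel T y z.
Proof.
move=> dT; rewrite /adjoint; case: pselect => // dT'; split=> [[/= h <-]|h].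
  exact: adjoint_funP.
have dy : adjoint_dom T y by exists z.
by split=> //=; exact: (adjoint_rel_uniq dT (adjoint_funP dy)).
Qed.

End Adjoint.

Section MoorePenrose.
Context {F : numFieldType} {theta : F -> F} {H K : hilbertType theta}.
Implicit Type T : operator H K.

Definition carrier T : set H := dom T `&` orth (null T).

Definition decomposable_domain T : Prop :=
  is_orth_sum (dom T) (null T) (carrier T).

Definition mp_dom T : set K := set_sum (ran T) (orth (ran T)).

(* x is the image of y under the Moore-Penrose inverse: writing y = T x + r
   with r orthogonal to the range, x is the preimage of T x in the carrier. *)
Definition mp_rel T (y : K) (x : H) : Prop :=
  carrier T x /\ orth (ran T) (y - T x).

Definition mp_fun T (y : K) : H := get (mp_rel T y).

Lemma op_sub T x y : dom T x -> dom T y ->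
  dom T (x - y) /\ T (x - y) = T x - T y.
Proof.
move=> Tx Ty; have e : x - y = (-1) *: y + x by rewrite scaleN1r addrC.
by split; rewrite e; [exact: dom_lin|rewrite op_lin // scaleN1r addrC].
Qed.

Lemma mp_rel_lin T a y1 x1 y2 x2 : mp_rel T y1 x1 -> mp_rel T y2 x2 ->
  mp_rel T (a *: y1 + y2) (a *: x1 + x2).
Proof.
move=> [[D1 N1] O1] [[D2 N2] O2]; split.
  by split; [exact: dom_lin|exact: orth_lin].
rewrite op_lin // opprD addrACA -scalerBr.
exact: orth_lin.
Qed.

Lemma mp_rel_uniq T y x x' : mp_rel T y x -> mp_rel T y x' -> x = x'.
Proof.
move=> [[D N] O] [[D' N'] O'].
have [Dd Td] := op_sub D D'.
have Td0 : T (x - x') = 0.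
  apply: inner_eq0.
  have R : ran T (T (x - x')) by exists (x - x').
  have e : T (x - x') = (-1) *: (y - T x) + (y - T x').
    by rewrite Td scaleN1r opprB addrA subrK.
  by rewrite {1}e; apply: orth_lin R.
apply/eqP; rewrite -subr_eq0; apply/eqP; apply: inner_eq0.
have nd : null T (x - x') by [].
by rewrite innerBl N // N' // subrr.
Qed.

Lemma mp_funP T y : decomposable_domain T -> mp_dom T y ->
  mp_rel T y (mp_fun T y).
Proof.
move=> [_ dT] [_ [x Tx <-] [r rT <-]].
have : set_sum (null T) (carrier T) x by rewrite -dT.
move=> [n [nD n0] [c cT nc]].
apply: (@getI _ _ c); split=> //.
suff -> : T x = T c by rewrite addrAC subrr add0r.
rewrite -nc -[n]scale1r op_lin ?n0 ?scaler0 ?add0r //.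
exact: cT.1.
Qed.

Lemma mp_dom0 T : mp_dom T 0.
Proof.
exists 0; first by exists 0; [exact: dom0|exact: op0].
by exists 0; rewrite ?addr0 // => y _; rewrite inner0l.
Qed.

Lemma mp_dom_lin T a y1 y2 : mp_dom T y1 -> mp_dom T y2 ->
  mp_dom T (a *: y1 + y2).
Proof.
move=> [_ [x1 D1 <-] [r1 O1 <-]] [_ [x2 D2 <-] [r2 O2 <-]].
exists (T (a *: x1 + x2)); first by exists (a *: x1 + x2) => //; exact: dom_lin.
exists (a *: r1 + r2); first exact: orth_lin.
by rewrite op_lin // scalerDr addrACA.
Qed.

Lemma mp_lin T (dT : decomposable_domain T) a y1 y2 :
  mp_dom T y1 -> mp_dom T y2 ->
  mp_fun T (a *: y1 + y2) = a *: mp_fun T y1 + mp_fun T y2.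
Proof.
move=> h1 h2; apply: (@mp_rel_uniq T (a *: y1 + y2)).
  exact/mp_funP/mp_dom_lin.
by apply: mp_rel_lin; exact: mp_funP.
Qed.

Definition mp_op T (dT : decomposable_domain T) : operator K H :=
  Operator (mp_dom0 T) (@mp_dom_lin T) (mp_lin dT).

(* The Moore-Penrose inverse is meaningful only for an operator with
   decomposable domain; zero_op is a default value. *)
Definition mp_inverse T : operator K H :=
  if pselect (decomposable_domain T) is left dT then mp_op dT else zero_op.

Lemma mp_inverse_carrier T x : decomposable_domain T -> carrier T x ->
  mp_inverse T (T x) = x.
Proof.
move=> dT cx; rewrite /mp_inverse; case: pselect => //= dT'.
have R : mp_rel T (T x) x.
  by split=> //; rewrite subrr => y _; rewrite inner0l.
exact: mp_rel_uniq (getI R) R.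
Qed.

Lemma mp_inverse_orth T y : decomposable_domain T -> orth (ran T) y ->
  mp_inverse T y = 0.
Proof.
move=> dT oy; rewrite /mp_inverse; case: pselect => //= dT'.
have R : mp_rel T y 0.
  split; last by rewrite op0 subr0.
  by split; [exact: dom0|move=> ? _; rewrite inner0l].
exact: mp_rel_uniq (getI R) R.
Qed.

End MoorePenrose.

(* Main.v *)
(* Write T' for the adjoint, T+ for the Moore-Penrose inverse, and R, N, C for
   range, null space and carrier.  Since D(T+) is the sum of R(T) and its
   orthogonal complement N(T'), the pair (u, v) is in the graph of (T+)' iff v is
   orthogonal to N(T') and <c, u> = <T c, v> for every c in C(T).  If w is the
   component of u orthogonal to N(T), decomposability of D(T) turns the last
   condition into T' v = w, where u - w is in the closure of N(T), hence
   orthogonal to R(T').  Conversely, v in C(T') with u - T' v orthogonal to R(T')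
   suffices: the orthogonal complement of R(T') is contained in the null space of
   the closure of T, which is the closure of N(T) by hypothesis. *)
Require Import Defs.
From mathcomp Require Import all_boot all_order all_algebra.
From mathcomp Require Import sesquilinear complex.
From mathcomp Require Import all_classical all_reals all_analysis.
From mathcomp Require Import ring.
Import Order.TTheory GRing.Theory Num.Theory.
Import numFieldNormedType.Exports.

Set Implicit Arguments.
Unset Strict Implicit.
Unset Printing Implicit Defensive.

Local Open Scope classical_set_scope.
Local Open Scope ring_scope.

(** * Scalars: the real and the complex case treated uniformly *)

Section Scalars.
Context {R : realType} {F : numFieldType} {theta : F -> F}.
Context (hF : real_or_complex R theta).

Lemma mul_theta s : s * theta s = `|s| ^+ 2.
Proof.
by case: hF s => s /=; [rewrite real_normK ?num_real// expr2|rewrite sqr_normc].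
Qed.

Lemma thetaD a b : theta (a + b) = theta a + theta b.
Proof. by case: hF a b => // a b; rewrite rmorphD. Qed.

Lemma thetaM a b : theta (a * b) = theta a * theta b.
Proof. by case: hF a b => // a b; rewrite rmorphM. Qed.

Lemma ger0_theta c : 0 <= c -> theta c = c.
Proof.
case: hF c => // -[a b]; rewrite lecE => /andP[/eqP /= -> _].
by rewrite oppr0.
Qed.

(** In the complex case the order makes nonnegative scalars real, so the infimum of the real parts
    serves. *)
Lemma nonneg_inf (A : set F) : A !=set0 -> (forall a, A a -> 0 <= a) ->
  exists d, (forall a, A a -> d <= a) /\
    forall e, 0 < e -> exists2 a, A a & a < d + e.
Proof.
case: hF A => A [a0 Aa0] A0.
- have hA : has_inf A by split; [exists a0|exists 0 => a /A0].
  exists (inf A); split=> [a Aa|e e0]; first exact: (ge_inf hA.2).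
  exact: inf_adherent.
- pose B : set R := [set complex.Re a | a in A].
  have hB : has_inf B.
    split; first by exists (complex.Re a0), a0.
    by exists 0 => _ [a /A0 + <-]; rewrite lecE => /andP[].
  exists (real_complex R (inf B)); split=> [a Aa|e].
    have := A0 _ Aa; rewrite !lecE /= => /andP[-> _] /=.
    by apply: (ge_inf hB.2); exists a.
  rewrite ltcE => /andP[/eqP /= e0 eR].
  have [_ [a Aa <-] ha] := inf_adherent eR hB.
  exists a => //; have := A0 _ Aa; rewrite lecE => /andP[/eqP /= a0' _].
  case: e e0 eR ha => e1 e2 /= -> eR ha.
  by case: a a0' ha {Aa} => a1 a2 /= -> ha; rewrite ltcE /= addr0 eqxx.
Qed.

End Scalars.

Lemma innerC (F : numFieldType) (theta : F -> F) (H : hilbertType theta)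
    (x y : H) : '[x, y] = theta '[y, x].
Proof.
have -> : '[x, y] = (-1) ^+ false * theta '[y, x].
  exact: (@hermitian_subproof _ _ _ _ inner).
by rewrite mul1r.
Qed.

Definition linear_set (F : numFieldType) (U : lmodType F) (G : set U) :=
  G 0 /\ forall a x y, G x -> G y -> G (a *: x + y).

(** * Inner products on a product space, and their continuity *)

Section Product.
Context {R : realType} {F : numFieldType} {theta : F -> F}.
Context (hF : real_or_complex R theta).
Context {H K : hilbertType theta}.
Implicit Types p q g h w : (H * K)%type.

(* The inner product of the Hilbert sum of H and K.  The normed module structure
   of H * K carries the maximum norm instead, but the same topology. *)
Definition inner2 p q : F := '[p.1, q.1] + '[p.2, q.2].

Lemma inner2_ge0 p : 0 <= inner2 p p.
Proof. by rewrite /inner2 !inner_norm addr_ge0 ?exprn_ge0. Qed.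

(* Taking a = '[w, h] / '[h, h] in the hypothesis.  For d = 0 this is the
   Cauchy-Schwarz inequality; for d the squared distance to a subspace
   containing h it says that almost minimal vectors are almost orthogonal. *)
Lemma inner2_sqr_le d e w h :
  (forall a, d <= inner2 (w - a *: h) (w - a *: h)) -> inner2 w w <= d + e ->
  `|inner2 w h| ^+ 2 <= e * inner2 h h.
Proof.
move=> hd hw.
have [h0|hN0] := eqVneq (inner2 h h) 0.
  have : `|h.1| ^+ 2 + `|h.2| ^+ 2 = 0 by rewrite -!inner_norm.
  move/eqP; rewrite paddr_eq0 ?exprn_ge0// !expf_eq0/= !normr_eq0.
  move=> /andP[/eqP h1 /eqP h2].
  by rewrite /inner2 h1 h2 !inner0r addr0 normr0 expr0n mulr0.
have N0 : 0 < inner2 h h by rewrite lt_def hN0 inner2_ge0.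
set s := inner2 w h; set c := inner2 h h.
have hs : inner2 h w = theta s by rewrite /s /inner2 (thetaD hF) -!innerC.
have := hd (s / c).
have -> : inner2 (w - (s / c) *: h) (w - (s / c) *: h) =
   inner2 w w - `|s| ^+ 2 / c.
  transitivity (inner2 w w - (s / c) * inner2 h w - theta (s / c) * s
     + (s / c) * theta (s / c) * c).
    by rewrite /s /c /inner2 !innerBl !innerBr !innerZl !innerZr; ring.
  rewrite (thetaM hF) (ger0_theta hF (c := c^-1)) ?invr_ge0 ?ltW//.
  rewrite hs -(mul_theta hF).
  by field.
rewrite lerBrDr => /le_trans /(_ hw).
by rewrite lerD2l ler_pdivrMr.
Qed.

End Product.

Section Continuity.
Context {R : realType} {F : numFieldType} {theta : F -> F}.
Context (hF : real_or_complex R theta).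
Context {H : hilbertType theta}.

Lemma cauchy_schwarz (x y : H) : `|'[x, y]| <= `|x| * `|y|.
Proof.
rewrite -(@ler_pXn2r _ 2)// ?nnegrE ?mulr_ge0//.
(* The case [d = 0], with [H] embedded in [H * H] as the first factor. *)
have := @inner2_sqr_le _ _ _ hF H H 0 (`|x| ^+ 2) (x, 0) (y, 0).
rewrite /inner2 /= !inner0r !addr0 !inner_norm add0r exprMn; apply=> // a.
by rewrite !inner_norm addr_ge0 ?exprn_ge0.
Qed.

Lemma inner_continuous (y : H) : continuous (fun x : H => '[x, y]).
Proof.
move=> x; apply/cvgrPdist_lt => e e0.
have c0 : 0 < `|y| + 1 by rewrite ltr_wpDl.
have /cvgrPdist_lt := @cvg_id _ (nbhs x).
move=> /(_ (e / (`|y| + 1)) (divr_gt0 e0 c0)); apply: filterS => z /= hz.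
rewrite -innerBl; apply: (le_lt_trans (cauchy_schwarz _ _)).
rewrite ltr_pdivlMr// in hz; apply: le_lt_trans hz.
by rewrite ler_wpM2l// lerDl.
Qed.

End Continuity.

(** * Projection onto the closure of a subspace *)

Section Projection.
Context {R : realType} {F : numFieldType} {theta : F -> F}.
Context (hF : real_or_complex R theta).
Context {H K : hilbertType theta}.

Lemma inner2_continuous (h : H * K) : continuous (fun q : H * K => inner2 q h).
Proof.
move=> q; apply: (@cvgD F F).
  apply: (@cvg_comp _ _ _ fst (fun x => '[x, h.1]) _ (nbhs q.1)).
    exact: cvg_fst.
  exact: (inner_continuous hF).
apply: (@cvg_comp _ _ _ snd (fun x => '[x, h.2]) _ (nbhs q.2)).
  exact: cvg_snd.
exact: (inner_continuous hF).
Qed.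

(** The squared distance from [p] is minimized over [G]; as [G] need not be closed, the minimizer
    lies in its closure. *)
Lemma inner2_projection (G : set (H * K)) p : linear_set G ->
  exists2 g, closure G g & forall h, G h -> inner2 (p - g) h = 0.
Proof.
move=> [G0 Glin].
have [|_ [g _ <-]|d [dle dinf]] :=
  @nonneg_inf _ _ _ hF [set inner2 (p - g) (p - g) | g in G].
- by exists (inner2 (p - 0) (p - 0)), 0.
- exact: inner2_ge0.
have {}dle g : G g -> d <= inner2 (p - g) (p - g).
  by move=> Gg; apply: dle; exists g.
(* The filter generated by the sets of almost minimizers replaces a minimizing sequence. *)
pose A e := [set g | G g /\ inner2 (p - g) (p - g) < d + e].
pose Phi := filter_from [set e : F | 0 < e] A.
have A_le e e' : e <= e' -> A e `<=` A e'.
  by move=> ee' g [Gg gd]; split=> //; apply: lt_le_trans gd _; rewrite lerD2l.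
have PhiF : ProperFilter Phi.
  apply: filter_from_proper; last first.
    by move=> e /dinf[_ [g Gg <-] gd]; exists g.
  apply: filter_from_filter; first by exists 1 => /=.
  move=> i j /= i0 j0.
  (* The order of [F] may be partial, but positive scalars are real and hence comparable. *)
  have /orP[ij|ij] : (i <= j) || (j <= i).
  - exact: real_leVge (gtr0_real i0) (gtr0_real j0).
  - by exists i => // g gi; split=> //; exact: A_le gi.
  - by exists j => // g gi; split=> //; exact: A_le gi.
(* The parallelogram law, since the midpoint of g and g' is in G. *)
have Adist e g g' : A e g -> A e g' -> inner2 (g - g') (g - g') <= 4 * e.
  move=> [Gg gd] [Gg' gd'].
  pose m := 2^-1 *: g + (2^-1 *: g' + 0).
  have := dle m (Glin _ _ _ Gg (Glin _ _ _ Gg' G0)).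
  have -> : inner2 (g - g') (g - g') = 2 * inner2 (p - g) (p - g) +
      2 * inner2 (p - g') (p - g') - 4 * inner2 (p - m) (p - m).
    rewrite /inner2 /= !innerBl !innerBr !innerDl !innerDr !innerZl !innerZr.
    rewrite !inner0l !inner0r (ger0_theta hF) ?invr_ge0//.
    by field.
  move=> dm; rewrite lerBlDr.
  apply: (@le_trans _ _ (2 * (d + e) + 2 * (d + e))).
    by rewrite lerD// ler_wpM2l// ltW.
  have -> : 2 * (d + e) + 2 * (d + e) = 4 * e + 4 * d by ring.
  by rewrite lerD2l ler_wpM2l.
have Acauchy e : 0 < e -> exists g,
    Phi [set g' | `|g.1 - g'.1| < e /\ `|g.2 - g'.2| < e].
  (* The factor 1/8 turns the bound of [Adist] into [e ^+ 2 / 2], which is below [e ^+ 2]. *)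
  move=> e0; have e'0 : 0 < e ^+ 2 / 8 by rewrite divr_gt0// exprn_gt0.
  have [_ [g Gg <-] gd] := dinf _ e'0.
  exists g, (e ^+ 2 / 8) => // g' g'A.
  have := Adist _ _ _ (conj Gg gd) g'A; rewrite /inner2 !inner_norm /= => hle.
  have lt (x y : F) : 0 <= x -> 0 <= y ->
      x ^+ 2 + y ^+ 2 <= 4 * (e ^+ 2 / 8) -> x < e.
    move=> x0 y0 xy; rewrite -(@ltr_pXn2r _ 2)// ?nnegrE ?ltW//.
    apply: (@le_lt_trans _ _ (4 * (e ^+ 2 / 8))).
      by apply: le_trans xy; rewrite lerDl exprn_ge0.
    have -> : 4 * (e ^+ 2 / 8) = e ^+ 2 / 2 by field.
    by rewrite ltr_pdivrMr// ltr_pMr ?exprn_gt0// ltr1n.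
  split; first exact: lt hle.
  by move: hle; rewrite addrC; exact: lt.
(* Completeness is applied in [H] and in [K] separately, and the limits are then paired. *)
have cvg1 : cvg (fst @ Phi).
  apply: cauchy_cvg; apply: cauchy_exP => e /Acauchy[g gP].
  exists g.1; rewrite -ball_normE /= /nbhs /=.
  by apply: filterS gP => g' [].
have cvg2 : cvg (snd @ Phi).
  apply: cauchy_cvg; apply: cauchy_exP => e /Acauchy[g gP].
  exists g.2; rewrite -ball_normE /= /nbhs /=.
  by apply: filterS gP => g' [].
have [l1 l1P] := (cvg_ex _).1 cvg1; have [l2 l2P] := (cvg_ex _).1 cvg2.
have Phil : Phi --> (l1, l2).
  move=> B /(cvg_pair (l1P : fst @ Phi --> l1) (l2P : snd @ Phi --> l2)) hB.
  by apply: (@filterS _ Phi _ _ B _ hB) => -[].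
exists (l1, l2).
  move=> B /Phil PB.
  have PG : Phi G by exists 1 => //= g [].
  by have [g [Gg Bg]] := filter_ex (filterI PG PB); exists g.
move=> h Gh.
have cv : inner2 (p - q) h @[q --> Phi] --> inner2 (p - (l1, l2)) h.
  apply: (@cvg_comp _ _ _ (fun q => p - q) (fun q => inner2 q h) Phi
    (nbhs (p - (l1, l2)))); last exact: inner2_continuous.
  by apply: cvgB => //; exact: cvg_cst.
(* The same quantity tends to 0 along [Phi]: on [A (e ^+ 2 / c)] its squared modulus is at most
   [e ^+ 2 / c * inner2 h h], and [c] exceeds [inner2 h h]. *)
apply: (cvg_unique (@norm_hausdorff _ F) cv).
apply/cvgrPdist_lt => e e0.
pose c := inner2 h h + 1.
have c0 : 0 < c by rewrite ltr_wpDl ?inner2_ge0.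
exists (e ^+ 2 / c); first by rewrite /= divr_gt0// exprn_gt0.
move=> g [Gg gd] /=; rewrite sub0r normrN.
rewrite -(@ltr_pXn2r _ 2)// ?nnegrE ?ltW//.
have le := inner2_sqr_le hF (d := d) (e := e ^+ 2 / c) (w := p - g) (h := h).
apply: le_lt_trans (le _ (ltW gd)) _.
  by move=> a; rewrite -addrA -opprD [g + _]addrC; apply/dle/Glin.
rewrite mulrAC ltr_pdivrMr// ltr_pM2l ?exprn_gt0//.
by rewrite /c ltrDl.
Qed.

End Projection.

(** * Orthogonal complements in one Hilbert space *)

Section OrthogonalComplement.
Context {R : realType} {F : numFieldType} {theta : F -> F}.
Context (hF : real_or_complex R theta).
Context {H K : hilbertType theta}.

Lemma continuous_eq0_closure (V : topologicalType) (f : V -> F) (G : set V) x :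
  continuous f -> (forall y, G y -> f y = 0) -> closure G x -> f x = 0.
Proof.
move=> cf Gf /(closureS (Gf : G `<=` f @^-1` [set 0])).
apply: preimage_closed => [y _|]; first exact: cf.
exact/accessible_closed_set1/hausdorff_accessible/norm_hausdorff.
Qed.

Lemma inner_closure (M : set H) w m : orth M w -> closure M m -> '[m, w] = 0.
Proof.
move=> Mw; apply: (@continuous_eq0_closure _ (fun x : H => '[x, w])).
  exact: (inner_continuous hF).
by move=> x Mx; exact/inner_eq0C/Mw.
Qed.

Lemma orth_projection (M : set H) u : linear_set M ->
  exists2 m, closure M m & orth M (u - m).
Proof.
move=> [M0 Mlin].
(* [M] is viewed as a subspace of [H * H] with second coordinate zero. *)
have [|g Gg go] := @inner2_projection _ _ _ hF H H
    [set q | M q.1 /\ q.2 = 0] (u, 0).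
  split=> //= a x y [x1 x2] [y1 y2]; split; first exact: Mlin.
  by rewrite /= x2 y2 scaler0 addr0.
exists g.1.
  move=> B /(@cvg_fst _ _ (nbhs g.1) (nbhs g.2) _) /Gg[q [[Mq _] Bq]].
  by exists q.1.
move=> h Mh; have := go (h, 0) (conj Mh erefl).
by rewrite /inner2 /= inner0r addr0.
Qed.

Lemma closure_orth (M : set H) : closure (orth M) `<=` orth M.
Proof.
move=> x xM a Ma; apply: (@inner_closure (orth M)) => // y yM.
exact/inner_eq0C/yM.
Qed.

End OrthogonalComplement.

Section LinearSets.
Context {F : numFieldType} {H K : lmodType F}.
Implicit Type T : operator H K.

Lemma null_linear T : linear_set (null T).
Proof.
split=> [|a x y [Dx x0] [Dy y0]]; first by split; [exact: dom0|exact: op0].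
by split; [exact: dom_lin|rewrite op_lin// x0 y0 scaler0 addr0].
Qed.

Lemma ran_linear T : linear_set (ran T).
Proof.
split=> [|a _ _ [x Dx <-] [y Dy <-]].
  by exists 0; [exact: dom0|exact: op0].
by exists (a *: x + y); [exact: dom_lin|rewrite op_lin].
Qed.

Lemma graph_linear T : linear_set (graph T).
Proof.
split=> [|a [x1 x2] [y1 y2] [/= Dx <-] [/= Dy <-]].
  by split; [exact: dom0|exact: op0].
by split; [exact: dom_lin|exact: op_lin].
Qed.

(** A graph records the domain and the values on it, so equality of operators reduces to an
    equivalence of relations. *)
Lemma op_eq_graph T S : (forall x y, graph T (x, y) <-> graph S (x, y)) ->
  op_eq T S.
Proof.
move=> TS; split=> [|x Tx].
  apply/seteqP; split=> x Dx.
    by have [/(_ (conj Dx erefl))[]] := TS x (T x).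
  by have [_ /(_ (conj Dx erefl))[]] := TS x (S x).
by have [/(_ (conj Tx erefl))[]] := TS x (T x).
Qed.

End LinearSets.

(** * Adjoints and Moore-Penrose inverses *)

Section Operators.
Context {R : realType} {F : numFieldType} {theta : F -> F}.
Context (hF : real_or_complex R theta).
Context {H K : hilbertType theta}.
Implicit Type T : operator H K.

Lemma null_adjoint T : densely_defined T -> null (adjoint T) = orth (ran T).
Proof.
move=> dT; apply/seteqP; split=> y.
  move=> [Dy y0] _ [x Tx <-]; apply: inner_eq0C.
  by rewrite ((adjointP y 0 dT).1 (conj Dy y0))// inner0r.
move=> yT; apply: (adjointP y 0 dT).2 => x Tx.
by rewrite inner0r; apply/inner_eq0C/yT; exists x.
Qed.

(* With (z, 0) - g orthogonal to the graph of T, (- g.2, g.1 - z) lies in the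
   graph of the adjoint, which forces g = (z, 0). *)
Lemma orth_ran_adjoint T : densely_defined T -> closable T ->
  orth (ran (adjoint T)) `<=` null (op_closure T).
Proof.
move=> dT /op_closureP[cS TS _] z zT.
have [g Gg go] := inner2_projection hF (z, 0) (graph_linear T).
have Sg : graph (op_closure T) g by exact/cS/(closureS TS).
(* [go] speaks of the graph itself, whereas [g] lies only in its closure; continuity bridges the
   gap. *)
have gw : inner2 g ((z, 0) - g) = 0.
  apply: (@continuous_eq0_closure _ _
    (fun q : H * K => inner2 q ((z, 0) - g))) Gg.
    exact: (inner2_continuous hF).
  move=> h /go.
  rewrite /inner2 (innerC h.1) (innerC h.2) -(thetaD hF) => ->.
  exact: (ger0_theta hF).
have adj : graph (adjoint T) (- g.2, g.1 - z).
  apply/(adjointP _ _ dT) => x Tx.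
  have := go (x, T x) (conj Tx erefl).
  rewrite /inner2 /= sub0r => /eqP; rewrite addrC addr_eq0 => /eqP e.
  rewrite [LHS]innerC [RHS]innerC e; congr theta.
  by rewrite -mulN1r -innerZl scaleN1r opprB.
have zg : '[z, g.1 - z] = 0.
  by apply: zT; case: adj => /= D <-; exists (- g.2).
have : '[z - g.1, z - g.1] + '[g.2, g.2] = 0.
  have -> : '[z - g.1, z - g.1] + '[g.2, g.2] =
      - '[z, g.1 - z] - inner2 g ((z, 0) - g).
    by rewrite /inner2 /= !innerBl !innerBr inner0r; ring.
  by rewrite zg gw subr0 oppr0.
move/eqP; rewrite !inner_norm paddr_eq0 ?exprn_ge0// !expf_eq0 /= !normr_eq0.
rewrite subr_eq0 => /andP[/eqP zg1 /eqP g20].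
by case: Sg; rewrite -zg1 g20.
Qed.

Lemma mp_inverseP T y x : decomposable_domain T ->
  graph (mp_inverse T) (y, x) <-> mp_rel T y x.
Proof.
move=> dT; rewrite /mp_inverse; case: pselect => // dT'; split=> [[/= h <-]|h].
  exact: mp_funP.
have dy : mp_dom T y.
  exists (T x); first by exists x; [exact: h.1.1|].
  by exists (y - T x); [exact: h.2|rewrite addrC subrK].
by split=> //=; exact: mp_rel_uniq (mp_funP dT dy) h.
Qed.

(** With [m] the projection of [y] on the closure of the range, moving [m] to a nearby [T x] moves
    [y] to [T x + (y - m)], which lies in the domain. *)
Lemma mp_inverse_dense T : decomposable_domain T ->
  densely_defined (mp_inverse T).
Proof.
move=> dT O [y Oy] oO.
have [m mT yT] := orth_projection hF y (ran_linear T).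
have : nbhs m [set v | O (v + (y - m))].
  have : nbhs (m + (y - m)) O by rewrite addrC subrK; exact: open_nbhs_nbhs.
  apply: (@cvgD _ _ _ (nbhs m) _ idfun (fun=> y - m)); first exact: cvg_id.
  exact: cvg_cst.
move=> /mT[_ [[x Tx <-] Ox]]; exists (T x + (y - m)); split=> //.
rewrite /mp_inverse; case: pselect => //= _.
by exists (T x); [exists x|exists (y - m)].
Qed.

(** The null space of the adjoint is an orthogonal complement, hence closed, so projecting onto it
    stays inside it and inside the domain. *)
Lemma adjoint_decomposable T : densely_defined T ->
  decomposable_domain (adjoint T).
Proof.
move=> dT; split; first by move=> a b aN [_ bN]; exact/inner_eq0C/bN.
apply/seteqP; split=> [y Dy|_ [n [Dn _] [c [Dc _] <-]]]; last first.
  by rewrite -[n]scale1r; exact: dom_lin.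
have [m mN ym] := orth_projection hF y (null_linear (adjoint T)).
have {}mN : null (adjoint T) m.
  by move: mN; rewrite null_adjoint//; exact: (closure_orth hF).
exists m => //; exists (y - m); last by rewrite addrC subrK.
by split=> //; exact: (op_sub Dy mN.1).1.
Qed.

End Operators.

Theorem theorem2p2 (R : realType) (F : numFieldType) (theta : F -> F)
    (hF : real_or_complex R theta) (H K : hilbertType theta)
    (T : operator H K)
    (hdense : densely_defined T)
    (hclosable : closable T)
    (hdecomp : decomposable_domain T)
    (hnull : null (op_closure T) = closure (null T)) :
  op_eq (adjoint (mp_inverse T)) (mp_inverse (adjoint T)).
Proof.
have dA := adjoint_decomposable hF hdense.
have domT x : dom T x ->
    exists n c, [/\ null T n, carrier T c, T x = T c & x = n + c].
  case: hdecomp => _ -> [n [Dn n0] [c cT <-]]; exists n, c; split=> //.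
  by rewrite -[n]scale1r op_lin ?n0 ?scaler0 ?add0r//; exact: cT.1.
apply: op_eq_graph => u v.
rewrite (adjointP _ _ (mp_inverse_dense hF hdecomp)) (mp_inverseP _ _ dA).
split=> [uv|[[Dv vN] uT]].
- have vR : orth (null (adjoint T)) v.
    rewrite null_adjoint// => r rR; apply: inner_eq0C.
    (* Testing [uv] on [r] orthogonal to the range, where the Moore-Penrose inverse vanishes, gives
       orthogonality of [v] and [r]. *)
    have /uv : dom (mp_inverse T) r.
      suff [] : graph (mp_inverse T) (r, 0) by [].
      apply/mp_inverseP => //; split; last by rewrite op0 subr0.
      by split; [exact: dom0|move=> ? _; rewrite inner0l].
    by rewrite mp_inverse_orth// inner0l => <-.
  have cv c : carrier T c -> '[c, u] = '[T c, v].
    move=> cT; have /uv : dom (mp_inverse T) (T c).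
      suff [] : graph (mp_inverse T) (T c, c) by [].
      apply/mp_inverseP => //; split=> // y _.
      by rewrite subrr inner0l.
    by rewrite mp_inverse_carrier.
  have [n nN wN] := orth_projection hF u (null_linear T).
  have [Dv Tv] : graph (adjoint T) (v, u - n).
    apply/adjointP => // x /domT[m [c [mN cT -> ->]]].
    rewrite -cv// innerDl (inner_eq0C (wN _ mN)) add0r innerBr.
    by rewrite (inner_eq0C (inner_closure hF cT.2 nN)) subr0.
  (* What remains of [u] is [n], a limit of elements of [null T], each orthogonal to the range of
     the adjoint. *)
  split=> //; rewrite Tv/= opprB addrC subrK => _ [y Dy <-].
  apply: (inner_closure hF) nN => m [Dm m0].
  apply: inner_eq0C.
  by rewrite -((adjointP _ _ hdense).1 (conj Dy erefl))// m0 inner0l.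
- move=> y Dy.
  have [xT yT] := (mp_inverseP y (mp_inverse T y) hdecomp).1 (conj Dy erefl).
  move: (mp_inverse T y) xT yT => x xT yT.
  have uN : closure (null T) (u - adjoint T v).
    by rewrite -hnull; exact: (orth_ran_adjoint hF).
  have Nv : '[y - T x, v] = 0.
    by apply/inner_eq0C/vN; rewrite null_adjoint.
  (* Only the component [T x] of [y] pairs with [v]; moving [T] across leaves [x] in the carrier
     against [u - adjoint T v] in the closure of [null T]. *)
  rewrite -[in RHS](subrK (T x) y) innerDl Nv add0r.
  apply: etrans (esym ((adjointP _ _ hdense).1 (conj Dv erefl) _ xT.1)).
  apply/eqP; rewrite -subr_eq0 -innerBr; apply/eqP/inner_eq0C.
  exact: (inner_closure hF xT.2 uN).
Qed.
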